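(* Let $F=f^n$ be an iterate of an expanding Thurston map $f\colon S^2\to S^2$, let $d=\deg F$, and let $\gamma\colon S^1\to S^2$ be an invariant Peano curve for $F$, i.e., a continuous surjection with $F(\gamma(z))=\gamma(z^d)$ for all $z\in S^1$. Let $\sim$ be the equivalence relation on $S^1$ given by $z\sim w\Leftrightarrow\gamma(z)=\gamma(w)$. Then the map $z^d/\!\sim\;\colon S^1/\!\sim\;\to S^1/\!\sim$, $[s]\mapsto[s^d]$, is well defined, the map $h\colon S^1/\!\sim\;\to S^2$, $h([s])=\gamma(s)$, is a homeomorphism, and $h\circ(z^d/\!\sim)=F\circ h$.
   Context: $S^1=\{z\in\mathbb C:|z|=1\}$. A Thurston map is an orientation-preserving branched covering $f\colon S^2\to S^2$ whose set of postcritical points $\operatorname{post}(f)=\bigcup_{j\ge1}f^j(\operatorname{crit}(f))$ is finite. Fix a Jordan curve $\mathcal C\supset\operatorname{post}(f)$. The map $f$ is expanding if the maximal diameter of a component of $S^2\setminus f^{-n}(\mathcal C)$ tends to $0$ as $n\to\infty$ (this does not depend on $\mathcal C$). *)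

(* Defs.v *)
From HB Require Import structures.
From mathcomp Require Import all_boot all_order all_algebra.
From mathcomp Require Import complex.
From mathcomp Require Import all_classical all_reals all_analysis.

Set Implicit Arguments.
Unset Strict Implicit.
Unset Printing Implicit Defensive.

Import Order.TTheory GRing.Theory Num.Theory.
Import numFieldNormedType.Exports.

Local Open Scope classical_set_scope.
Local Open Scope ring_scope.
Local Open Scope complex_scope.
Local Open Scope quotient_scope.

(* The carrier [R[i]] has no topology of its own; [^o] supplies the one
   induced by the complex modulus. *)
Definition Cplx (R : realType) := (R[i])^o.

Definition S1 (R : realType) : topologicalType :=
  set_type [set z : Cplx R | `|z| = 1].

Definition S2 (R : realType) : topologicalType :=
  set_type [set x : 'rV[R]_3 | \sum_(i < 3) x 0 i ^+ 2 = 1].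

Lemma S1_pow_subproof (R : realType) (d : nat) (z : S1 R) :
  (val z : Cplx R) ^+ d \in [set w : Cplx R | `|w| = 1].
Proof.
by case: z => z /= /set_mem /= hz; apply/mem_set => /=; rewrite normrX hz expr1n.
Qed.

Definition S1_pow (R : realType) (d : nat) (z : S1 R) : S1 R :=
  exist _ ((val z : Cplx R) ^+ d) (S1_pow_subproof d z).

Definition homeomorphism (X Y : topologicalType) (h : X -> Y) : Prop :=
  exists g : Y -> X, [/\ cancel h g, cancel g h, continuous h & continuous g].

Definition homeomorphism_on (X Y : topologicalType)
    (U : set X) (V : set Y) (phi : X -> Y) : Prop :=
  exists psi : Y -> X,
    [/\ {homo phi : x / U x >-> V x}, {homo psi : y / V y >-> U y},
        (forall x, U x -> psi (phi x) = x) /\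
        (forall y, V y -> phi (psi y) = y),
        {within U, continuous phi} & {within V, continuous psi}].

(* [c] is thought of as a closed curve of period [2 * pi]; [theta] is a
   continuous choice of the argument of [c - w]. *)
Definition has_winding_number (R : realType)
    (c : R -> Cplx R) (w : Cplx R) (k : int) : Prop :=
  (forall t, c t != w) /\
  exists theta : R -> R,
    [/\ continuous theta,
        forall t, c t - w = `|c t - w| * (cos (theta t) +i* sin (theta t))
      & theta (2 * pi) - theta 0 = 2 * pi * k%:~R].

(* [S2] is oriented by its outward normal.  If [M] is a rotation matrix with
   last row [x], the first two rows form a positively oriented orthonormal
   basis of the tangent plane at [x], and
     t |-> sin r cos t *: row 0 M + sin r sin t *: row 1 M + cos r *: row 2 M
   is the positively oriented circle of spherical radius [r] about [x].  A
   homeomorphism preserves the orientation at [x] when the images of the small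
   circles about [x] wind exactly once, counterclockwise, around its value
   at [x]. *)
Definition preserves_orientation_at (R : realType)
    (phi : S2 R -> Cplx R) (x : S2 R) : Prop :=
  forall M : 'M[R]_3,
    M *m M^T = 1%:M -> \det M = 1 -> row ord_max M = val x ->
    \forall r \near 0^'+, forall c : R -> S2 R,
      (forall t, val (c t) =
         (\row_(j < 3) [:: sin r * cos t; sin r * sin t; cos r]`_j) *m M) ->
      has_winding_number (phi \o c) (phi x) 1.

Definition oriented_chart (R : realType)
    (U : set (S2 R)) (U' : set (Cplx R)) (phi : S2 R -> Cplx R) : Prop :=
  [/\ open U, open U', homeomorphism_on U U' phi
    & forall x, U x -> preserves_orientation_at phi x].

Definition locally_power (R : realType)
    (f : S2 R -> S2 R) (p : S2 R) (k : nat) : Prop :=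
  (0 < k)%N /\
  exists (U V : set (S2 R)) (U' V' : set (Cplx R)) (phi psi : S2 R -> Cplx R),
    [/\ oriented_chart U U' phi, oriented_chart V V' psi,
        [/\ U p, V (f p), phi p = 0 & psi (f p) = 0],
        {homo f : x / U x >-> V x}
      & forall x, U x -> psi (f x) = phi x ^+ k].

Definition branched_covering (R : realType) (f : S2 R -> S2 R) : Prop :=
  continuous f /\ forall p, exists k, locally_power f p k.

Definition local_degree (R : realType) (f : S2 R -> S2 R) (p : S2 R) : nat :=
  xget 0%N [set k | locally_power f p k].

(* The number of preimages of a point counted with multiplicity, which for a
   branched covering is the same for all points. *)
Definition degree (R : realType) (f : S2 R -> S2 R) : nat :=
  xget 0%N [set d | forall q : S2 R,
    (\big[addn/0]_(p \in f @^-1` [set q]) local_degree f p)%N = d].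

Definition crit (R : realType) (f : S2 R -> S2 R) : set (S2 R) :=
  [set p | (1 < local_degree f p)%N].

Definition post (R : realType) (f : S2 R -> S2 R) : set (S2 R) :=
  \bigcup_(j in [set j | (1 <= j)%N]) (iter j f @` crit f).

Definition Thurston_map (R : realType) (f : S2 R -> S2 R) : Prop :=
  branched_covering f /\ finite_set (post f).

Definition Jordan_curve (R : realType) (C : set (S2 R)) : Prop :=
  exists2 g : S1 R -> S2 R, continuous g /\ injective g & C = range g.

Definition dist (R : realType) (x y : S2 R) : R :=
  Num.sqrt (\sum_(i < 3) (val x 0 i - val y 0 i) ^+ 2).

Definition diameter (R : realType) (A : set (S2 R)) : \bar R :=
  ereal_sup [set (dist xy.1 xy.2)%:E | xy in A `*` A].

Definition mesh (R : realType)
    (f : S2 R -> S2 R) (C : set (S2 R)) (n : nat) : \bar R :=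
  let A := ~` (iter n f @^-1` C) in
  ereal_sup [set diameter (connected_component A x) | x in A].

Definition expanding (R : realType) (f : S2 R -> S2 R) : Prop :=
  exists C : set (S2 R),
    [/\ Jordan_curve C, post f `<=` C & mesh f C @ \oo --> 0%E].

Definition invariant_Peano_curve (R : realType)
    (F : S2 R -> S2 R) (gamma : S1 R -> S2 R) : Prop :=
  [/\ continuous gamma, range gamma = setT
    & forall z, F (gamma z) = gamma (S1_pow (degree F) z)].

Definition same_image (R : realType) (gamma : S1 R -> S2 R) : rel (S1 R) :=
  fun z w => gamma z == gamma w.

Lemma same_image_equiv (R : realType) (gamma : S1 R -> S2 R) :
  equiv_class_of (same_image gamma).
Proof.
split=> [z|z w|w z t]; rewrite /same_image.
- exact: eqxx.
- exact: eq_sym.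
- by move=> /eqP ->.
Qed.

Canonical same_image_equiv_rel (R : realType) (gamma : S1 R -> S2 R) :=
  EquivRelPack (same_image_equiv gamma).

Definition S1_quotient (R : realType) (gamma : S1 R -> S2 R) :
    topologicalType :=
  quotient_topology {eq_quot (same_image gamma)}.

Definition S1_class (R : realType) (gamma : S1 R -> S2 R) (s : S1 R) :
  S1_quotient gamma := \pi_(S1_quotient gamma) s.

(* Main.v *)
(** The semiconjugacy [F \o gamma = gamma \o z^d] makes [z^d] respect the fibres
    of [gamma]. The induced map [h] is a continuous bijection from a quotient
    of the compact circle onto the Hausdorff sphere, hence a homeomorphism. *)

Require Import Defs.
From mathcomp Require Import all_boot all_order all_algebra.
From mathcomp Require Import complex lra.
From mathcomp Require Import all_classical all_reals all_analysis.

Import Order.TTheory GRing.Theory Num.Theory.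
Import numFieldNormedType.Exports.

Local Open Scope classical_set_scope.
Local Open Scope ring_scope.

(** If all neighbourhoods of [x] and [y] meet, then so do those of [f x] and [f y], because their
    preimages do. Applied to the inclusion of the sphere into R^3. *)
Lemma continuous_injective_hausdorff (X Y : topologicalType) (f : X -> Y) :
  continuous f -> injective f -> hausdorff_space Y -> hausdorff_space X.
Proof.
move=> cf injf hY x y clxy; apply/injf/hY => A B nA nB.
have [z [Az Bz]] := clxy _ _ (cf x A nA) (cf y B nB).
by exists (f z).
Qed.

(** A closed subset of [X] is compact, so its image under [h] is compact and therefore closed in
    [Y]. Thus [h] is a closed map, which is continuity of its inverse. *)
Lemma compact_hausdorff_homeomorphism (X Y : topologicalType) (h : X -> Y) :
  compact [set: X] -> hausdorff_space Y -> continuous h -> injective h ->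
  range h = setT -> homeomorphism h.
Proof.
move=> cX hY ch injh surjh.
have /choice[g hg] (y : Y) : exists x, h x = y.
  by have [x _ <-] : range h y; [rewrite surjh | exists x].
exists g; split=> //; first by move=> x; apply: injh; rewrite hg.
apply/continuous_closedP => A cA.
have -> : g @^-1` A = h @` A.
  apply/seteqP; split=> [y Ay|_ [x Ax <-]] /=; first by exists (g y).
  by rewrite /preimage/= (injh _ _ (hg (h x))).
apply: compact_closed => //; apply: continuous_compact.
  exact: continuous_subspaceT.
by apply: (subclosed_compact cA cX).
Qed.

(** A proper filter on the subspace, pushed forward along the inclusion, clusters at a point of [A].
    It clusters there in the subspace too, whose open sets are traces of open sets of [T]. *)
Lemma compact_set_type (T : topologicalType) (A : set T) :
  compact A -> compact [set: set_type A].
Proof.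
move=> cA F PF _.
pose i : set_type A -> T := set_val.
have iFA : (i @ F) A by rewrite fmapE; apply: filterE => x; exact: set_valP.
have [p [Ap clp]] := cA _ (fmap_proper_filter i PF) iFA.
exists (SigSub (mem_set Ap)); split=> // B C FB [_ [[U oU <-] Up UC]].
have iB : (i @ F) (i @` B).
  by rewrite fmapE; apply: filterS FB => x Bx; exists x.
have [_ [[x Bx <-] Ux]] := clp _ _ iB (open_nbhs_nbhs (conj oU Up)).
by exists x; split=> //; exact: UC.
Qed.

Lemma continuous_complex_of_pair (R : realType) :
  continuous (fun p : R * R => Complex p.1 p.2 : Cplx R).
Proof.
move=> [a b]; apply/cvgrPdist_lt => -[e1 e2].
(* A positive complex number has imaginary part [e2 = 0] and real part [e1 > 0]. *)
rewrite ltcE /= => /andP[/eqP -> e0].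
have e20 : 0 < e1 / 2 by rewrite divr_gt0.
have near1 : \forall p \near nbhs (a, b), `|a - p.1| < e1 / 2.
  exact: (@cvgr_dist_lt _ R _ _ _ (fun p : R * R => p.1) (a : R)
    (@cvg_fst _ _ (nbhs a) (nbhs b) _)).
have near2 : \forall p \near nbhs (a, b), `|b - p.2| < e1 / 2.
  exact: (@cvgr_dist_lt _ R _ _ _ (fun p : R * R => p.2) (b : R)
    (@cvg_snd _ _ (nbhs a) (nbhs b) _)).
apply: filterS2 near1 near2 => p pa pb.
rewrite normc_def ltcR /=.
apply: (@le_lt_trans _ _ (`|a - p.1| + `|b - p.2|)); last lra.
(* The modulus is at most the sum of the coordinate distances: written as the root of its square,
   that sum only adds a nonnegative cross term under the root. *)
rewrite -(ger0_norm (addr_ge0 (normr_ge0 (a - p.1)) (normr_ge0 (b - p.2)))).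
rewrite -sqrtr_sqr ler_wsqrtr// [leRHS]sqrrD !real_normK ?num_real//.
by rewrite addrAC lerDl mulrn_wge0 ?mulr_ge0.
Qed.

(** In real coordinates the circle is a closed subset of the compact square [[-1, 1]^2]. *)
Lemma compact_unit_circle (R : realType) :
  compact [set z : Cplx R | `|z| = 1].
Proof.
pose K := [set p : R * R | p.1 ^+ 2 + p.2 ^+ 2 = 1].
have -> : [set z : Cplx R | `|z| = 1] =
    (fun p : R * R => Complex p.1 p.2 : Cplx R) @` K.
  apply/seteqP; split=> [[a b]|_ [[a b] /= ab <-]].
    rewrite /= normc_def /= => -[ab]; exists (a, b) => //=.
    by rewrite /K/= -[LHS]sqr_sqrtr ?ab ?expr1n// addr_ge0 ?sqr_ge0.
  by rewrite /= normc_def /= ab sqrtr1.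
apply: continuous_compact.
  exact/continuous_subspaceT/continuous_complex_of_pair.
apply: (@subclosed_compact _ _ (`[-1 : R, 1] `*` `[-1 : R, 1])).
- rewrite (_ : K = (fun p => p.1 ^+ 2 + p.2 ^+ 2) @^-1` [set 1])//.
  apply: preimage_closed; last exact: closed_eq.
  move=> p _; apply: cvgD; rewrite expr2; apply: cvgM;
    (exact: cvg_fst || exact: cvg_snd).
- by apply: compact_setX; exact: segment_compact.
- move=> [a b]; rewrite /K /= !in_itv /= => ab.
  by split; apply/andP; split; nra.
Qed.

Lemma compact_S1 (R : realType) : compact [set: S1 R].
Proof. exact/compact_set_type/compact_unit_circle. Qed.

Lemma hausdorff_S2 (R : realType) : hausdorff_space (S2 R).
Proof.
apply: (@continuous_injective_hausdorff _ 'rV[R]_3 (@set_val _ _)).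
- exact: initial_continuous.
- exact: val_inj.
- exact: norm_hausdorff.
Qed.

Lemma S1_classP (R : realType) (gamma : S1 R -> S2 R) (z w : S1 R) :
  S1_class gamma z = S1_class gamma w <-> gamma z = gamma w.
Proof.
have class_eqP := @eqmodP _ (same_image_equiv_rel gamma) z w.
by split=> [/class_eqP/eqP|zw]; last exact/class_eqP/eqP.
Qed.

(** The projection is continuous and maps the compact circle onto the quotient. *)
Lemma compact_S1_quotient (R : realType) (gamma : S1 R -> S2 R) :
  compact [set: S1_quotient gamma].
Proof.
have -> : [set: S1_quotient gamma] = range (S1_class gamma).
  by apply/seteqP; split=> // x _; exists (repr x) => //; exact: reprK.
apply: continuous_compact (@compact_S1 R).
exact/continuous_subspaceT/pi_continuous.
Qed.

Theorem theorem1p5 (R : realType) (f : S2 R -> S2 R) (n : nat)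
    (gamma : S1 R -> S2 R) (F : S2 R -> S2 R) (d : nat)
    (hf : Thurston_map f) (hexp : expanding f)
    (hF : F = iter n f) (hd : d = degree F)
    (hgamma : invariant_Peano_curve F gamma) :
  (forall z w : S1 R, same_image gamma z w ->
     same_image gamma (S1_pow d z) (S1_pow d w)) /\
  exists (powd : S1_quotient gamma -> S1_quotient gamma)
         (h : S1_quotient gamma -> S2 R),
    [/\ forall s : S1 R, powd (S1_class gamma s) = S1_class gamma (S1_pow d s),
        forall s : S1 R, h (S1_class gamma s) = gamma s,
        homeomorphism h
      & h \o powd = F \o h].
Proof.
have [cg surjg gF] := hgamma; rewrite -hd in gF.
have powd_compat z w : gamma z = gamma w ->
    gamma (S1_pow d z) = gamma (S1_pow d w).
  by move=> zw; rewrite -!gF zw.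
split; first by move=> z w /eqP /powd_compat /eqP.
have gamma_repr s : gamma (repr (S1_class gamma s)) = gamma s.
  by apply/S1_classP; exact: reprK.
(* Both maps are evaluated on the chosen representative; [powd_compat] and [gamma_repr] show that
   the choice does not matter. *)
exists (fun x => S1_class gamma (S1_pow d (repr x))), (gamma \o repr); split.
- by move=> s; apply/S1_classP/powd_compat.
- exact: gamma_repr.
- apply: compact_hausdorff_homeomorphism.
  + exact: compact_S1_quotient.
  + exact: hausdorff_S2.
  (* Universal property of the quotient topology: [gamma] is continuous and constant on classes. *)
  + by apply: repr_comp_continuous => // z w /eqP /S1_classP /eqP.
  (* Representatives with equal images under [gamma] lie in one class, and their classes are [x] and
     [y]. *)
  + by move=> x y /= /S1_classP; rewrite /S1_class !reprK.
  + apply/seteqP; split=> // y _.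
    have [s _ <-] : range gamma y by rewrite surjg.
    by exists (S1_class gamma s) => //=.
- by apply/funext => x /=; rewrite gamma_repr gF.
Qed.
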